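(* Let $\mathfrak{g}$ be a compact semisimple Lie algebra with complexification $\mathfrak{g}^{\mathbb{C}}$, let $\xi\in\mathfrak{g}$, and for $r\in\mathbb{R}$ let $\mathfrak{g}_r\leq\mathfrak{g}^{\mathbb{C}}$ denote the $\sqrt{-1}\,r$-eigenspace of $\operatorname{ad}\xi$ acting on $\mathfrak{g}^{\mathbb{C}}$ (with $\mathfrak{g}_r=\{0\}$ if $\sqrt{-1}\,r$ is not an eigenvalue). Then $\xi$ is the canonical element of some parabolic subalgebra of $\mathfrak{g}^{\mathbb{C}}$ if and only if both of the following hold: (1) $\operatorname{ad}\xi$ has eigenvalues in $\sqrt{-1}\,\mathbb{Z}$; (2) $\mathfrak{g}^{\mathbb{C}}$ is generated (as a Lie algebra) by $\mathfrak{g}_1\oplus\mathfrak{g}_0\oplus\mathfrak{g}_{-1}$.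
   Context: Here $\mathfrak{g}$ is a real Lie algebra with negative definite Killing form. A subalgebra $\mathfrak{q}\leq\mathfrak{g}^{\mathbb{C}}$ is parabolic if it contains a maximal solvable subalgebra of $\mathfrak{g}^{\mathbb{C}}$; equivalently, if the polar $\mathfrak{q}^{\perp}$ of $\mathfrak{q}$ with respect to the Killing form of $\mathfrak{g}^{\mathbb{C}}$ is a nilpotent subalgebra. In that case $\mathfrak{q}^{\perp}$ is the nilradical of $\mathfrak{q}$. The whole algebra $\mathfrak{g}^{\mathbb{C}}$ counts as a parabolic subalgebra (with nilradical $\{0\}$). Canonical element: let $\mathfrak{q}\leq\mathfrak{g}^{\mathbb{C}}$ be parabolic with nilradical $\mathfrak{n}=\mathfrak{q}^{\perp}$, and let $\mathfrak{n}^{(r)}$, $r\geq1$, be its central descending series: $\mathfrak{n}^{(1)}=\mathfrak{n}$ and $\mathfrak{n}^{(r+1)}=[\mathfrak{n},\mathfrak{n}^{(r)}]$ for $r\geq 1$. By a theorem of Burstall and Rawnsley, there is a unique $\xi\in\mathfrak{g}$, called the canonical element of $\mathfrak{q}$, such that: (i) the eigenvalues of $\operatorname{ad}\xi$ on $\mathfrak{g}^{\mathbb{C}}$ lie in $\sqrt{-1}\,\mathbb{Z}$; (ii) writing $\mathfrak{g}_i$ for the $\sqrt{-1}\,i$-eigenspace of $\operatorname{ad}\xi$ in $\mathfrak{g}^{\mathbb{C}}$, $i\in\mathbb{Z}$, one has $\mathfrak{q}=\sum_{i\geq0}\mathfrak{g}_i$ and $\mathfrak{n}^{(r)}=\sum_{i\geq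 r}\mathfrak{g}_i$ for all $r\geq1$. *)

(* Defs.v *)
From HB Require Import structures.
From mathcomp Require Import all_boot all_order all_algebra ssrAC.
From mathcomp Require Import complex.

Set Implicit Arguments.
Unset Strict Implicit.
Unset Printing Implicit Defensive.

Import Order.TTheory GRing.Theory Num.Theory passmx.
Local Open Scope ring_scope.
Local Open Scope complex_scope.

HB.mixin Record Vector_isLie (F : fieldType) L of Vector F L := {
  lie : L -> L -> L;
  lie_linearl : forall y, linear (lie^~ y);
  lie_linearr : forall x, linear (lie x);
  lie_alt : forall x, lie x x = 0;
  lie_jacobi : forall x y z,
    lie x (lie y z) + lie y (lie z x) + lie z (lie x y) = 0
}.

#[short(type="lieAlgType")]
HB.structure Definition LieAlgebra (F : fieldType) :=
  {L of Vector_isLie F L & Vector F L}.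

Arguments lie {F s} x y.

Section LieTheory.
Variables (F : fieldType) (L : lieAlgType F).
Implicit Types (x y : L) (U V W : {vspace L}).

HB.instance Definition _ x :=
  GRing.isLinear.Build F L L _ (lie x) (@lie_linearr F L x).

Lemma lieDl x x' y : lie (x + x') y = lie x y + lie x' y.
Proof. by have := lie_linearl y 1 x x'; rewrite !scale1r. Qed.

Lemma lieZl a x y : lie (a *: x) y = a *: lie x y.
Proof.
have lie0l : lie 0 y = 0.
  by apply: (addrI (lie 0 y)); rewrite -lieDl !addr0.
by have := lie_linearl y a x 0; rewrite !addr0 lie0l addr0.
Qed.

Lemma lieNl x y : lie (- x) y = - lie x y.
Proof. by rewrite -scaleN1r lieZl scaleN1r. Qed.

Lemma lieDr x y y' : lie x (y + y') = lie x y + lie x y'.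
Proof. exact: linearD. Qed.

Lemma lieZr a x y : lie x (a *: y) = a *: lie x y.
Proof. exact: linearZ. Qed.

Lemma lieNr x y : lie x (- y) = - lie x y.
Proof. exact: linearN. Qed.

Lemma lie_anti x y : lie x y = - lie y x.
Proof.
have := lie_alt (x + y).
rewrite lieDr !lieDl !lie_alt add0r addr0 => /eqP.
by rewrite addrC addr_eq0 => /eqP.
Qed.

Definition ad x : 'End(L) := linfun (lie x).

Lemma adE x y : ad x y = lie x y.
Proof. exact: lfunE. Qed.

Lemma ad_linear : linear ad.
Proof.
by move=> a x y; apply/lfunP=> z; rewrite !lfunE /= !lfunE /= lie_linearl lfunE.
Qed.

HB.instance Definition _ := GRing.isLinear.Build F L 'End(L) _ ad ad_linear.

Definition lftrace (f : 'End(L)) : F :=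
  \tr (mxof (vbasis {:L}) (vbasis {:L}) f).

Definition killing x y : F := lftrace (ad x \o ad y)%VF.

Lemma killing_linearl y : scalar (killing^~ y).
Proof.
move=> a x x'.
by rewrite /killing /lftrace linearP comp_lfunDl -comp_lfunZl !linearP.
Qed.

Lemma killing_linearr x : scalar (killing x).
Proof.
move=> a y y'.
by rewrite /killing /lftrace linearP comp_lfunDr -comp_lfunZr !linearP.
Qed.

HB.instance Definition _ x :=
  GRing.isLinear.Build F L F^o _ (killing x) (killing_linearr x).

Definition polar U : {vspace L} :=
  (\bigcap_(y <- vbasis U) lker (linfun (killing y : L -> F^o)))%VS.

Lemma polarP U x : reflect (forall y, y \in U -> killing y x = 0) (x \in polar U).
Proof.
have capP (s : seq L) : (x \in (\bigcap_(y <- s)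
    lker (linfun (killing y : L -> F^o)))%VS) = all (fun y => killing y x == 0) s.
  elim: s => [|y s IHs]; first by rewrite big_nil memvf.
  by rewrite big_cons memv_cap IHs memv_ker lfunE.
rewrite /polar capP; apply: (iffP allP) => [h y yU | h y /vbasis_mem yU].
  pose kx : {linear L -> F^o} := HB.pack (fun z : L => killing z x : F^o)
    (GRing.isLinear.Build F L F^o _ _ (killing_linearl x)).
  rewrite -[killing y x]/(kx y) (coord_vbasis yU) linear_sum big1 // => i _.
  rewrite linearZ /=; have /h/eqP-> : (vbasis U)`_i \in vbasis U.
    by apply: mem_nth; rewrite size_tuple.
  by rewrite scaler0.
by rewrite h.
Qed.

(* The span of all brackets [u, v] with u in U and v in V. *)
Definition lie_prodv U V : {vspace L} :=
  (<<[seq lie u v | u <- vbasis U, v <- vbasis V]>>)%VS.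

Lemma lie_prodvP U V W :
  reflect (forall u v, u \in U -> v \in V -> lie u v \in W)
          (lie_prodv U V <= W)%VS.
Proof.
apply: (iffP span_subvP) => [h u v uU vV | h _ /allpairsP[[u v] [/= uU vV ->]]].
  rewrite (coord_vbasis vV) linear_sum memv_suml // => j _.
  rewrite linearZ memvZ //=; set b := (vbasis V)`_j.
  pose lb : {linear L -> L} := HB.pack (fun z : L => lie z b)
    (GRing.isLinear.Build F L L _ _ (lie_linearl b)).
  rewrite -[lie u b]/(lb u) (coord_vbasis uU) linear_sum memv_suml // => i _.
  rewrite linearZ memvZ //=; apply/h/allpairsP.
  by exists ((vbasis U)`_i, b); split=> //=; apply: mem_nth; rewrite size_tuple.
by apply: h; exact: vbasis_mem.
Qed.

Definition lie_subalg U : bool := (lie_prodv U U <= U)%VS.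

Definition lie_solvable U : Prop :=
  exists k, iter k (fun V => lie_prodv V V) U = 0%VS.

Definition max_solvable_subalg B : Prop :=
  [/\ lie_subalg B, lie_solvable B &
      forall B', lie_subalg B' -> lie_solvable B' -> (B <= B')%VS -> B' = B].

Definition parabolic U : Prop :=
  lie_subalg U /\ exists2 B, max_solvable_subalg B & (B <= U)%VS.

(* Indexed from 1: the first term is U itself (the value at 0 is junk). *)
Definition central_series U (r : nat) : {vspace L} :=
  iter r.-1 (lie_prodv U) U.

(* The Lie algebra generated by U, as the intersection of all subalgebras
   containing U, is the whole of L. *)
Definition lie_generates U : Prop :=
  forall x V, lie_subalg V -> (U <= V)%VS -> x \in V.

End LieTheory.

(* x + iy is encoded as the pair (x, y). *)
Definition complexification (R : rcfType) (g : lmodType R) : Type := (g * g)%type.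

Section Complexification.
Variables (R : rcfType).

Section Lmodule.
Variable g : lmodType R.
Local Notation gC := (complexification g).

HB.instance Definition _ := GRing.Zmodule.copy gC (g * g)%type.

Definition scaleC (a : R[i]) (u : gC) : gC :=
  let: a1 +i* a2 := a in (a1 *: u.1 - a2 *: u.2, a1 *: u.2 + a2 *: u.1).

Fact scaleCA a b u : scaleC a (scaleC b u) = scaleC (a * b) u.
Proof.
case: a b u => [a a'] [b b'] [x y]; congr (_, _) => /=.
  rewrite !scalerDr !scalerN !scalerA scalerBl scalerDl !opprD.
  by rewrite [X in _ + X]addrC addrACA.
rewrite !scalerDr !scalerN !scalerA scalerBl scalerDl.
by rewrite [X in _ + X]addrC addrACA.
Qed.

Fact scaleC1 : left_id 1 scaleC.
Proof. by case=> x y; rewrite /scaleC /= !scale1r !scale0r subr0 addr0. Qed.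

Fact scaleCDr : right_distributive scaleC +%R.
Proof.
by move=> [a a'] [x y] [x' y']; congr (_, _);
  rewrite /= !scalerDr ?opprD addrACA.
Qed.

Fact scaleCDl u : {morph scaleC^~ u : a b / a + b}.
Proof.
by case: u => x y [a a'] [b b']; congr (_, _);
  rewrite /= !scalerDl ?opprD addrACA.
Qed.

HB.instance Definition _ :=
  GRing.Zmodule_isLmodule.Build R[i] gC scaleCA scaleC1 scaleCDr scaleCDl.

End Lmodule.

Section Vector.
Variable g : vectType R.
Local Notation gC := (complexification g).
Import VectorInternalTheory.

Fact complexification_vect : Vector.axiom (dim g) gC.
Proof.
exists (fun u : gC => \row_k (v2r u.1 0 k +i* v2r u.2 0 k)).
  move=> [a b] [x y] [x' y']; apply/rowP=> k; rewrite !mxE /=.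
  rewrite !linearD !linearN !linearZ /= !mxE.
  by rewrite mulrN.
pose h (r : 'rV[R[i]]_(dim g)) : gC :=
  (r2v (map_mx (@complex.Re R) r), r2v (map_mx (@complex.Im R) r)).
apply: (@Bijective _ _ _ h) => [[x y]|r].
  by congr (_, _) => /=; apply: (can_inj v2rK); rewrite r2vK; apply/rowP=> k;
    rewrite !mxE.
apply/rowP=> k; rewrite !mxE /= !r2vK !mxE.
by case: (r 0 k).
Qed.

HB.instance Definition _ :=
  Lmodule_hasFinDim.Build R[i] gC complexification_vect.

End Vector.

Section Lie.
Variable g : lieAlgType R.
Local Notation gC := (complexification g).

Definition lieC (u v : gC) : gC :=
  (lie u.1 v.1 - lie u.2 v.2, lie u.1 v.2 + lie u.2 v.1).

Fact lieC_alt u : lieC u u = 0.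
Proof.
case: u => x y; rewrite /lieC /= !lie_alt subr0; congr (_, _).
by rewrite [lie y x]lie_anti subrr.
Qed.

Fact lieC_linearr u : linear (lieC u).
Proof.
case: u => u1 u2 [a a'] [x y] [x' y']; congr (_, _) => /=.
  rewrite !(lieDr, lieNr, lieZr) !scalerDr !scalerN !opprD.
  by rewrite [LHS]addrACA; congr (_ + _); rewrite addrACA.
rewrite !(lieDr, lieNr, lieZr) !scalerDr !scalerN.
by rewrite [LHS]addrACA; congr (_ + _); rewrite addrACA.
Qed.

Fact lieC_anti u v : lieC u v = - lieC v u.
Proof.
case: u v => [u1 u2] [v1 v2]; congr (_, _) => /=.
  by rewrite opprD opprK lie_anti [lie u2 v2]lie_anti opprK.
by rewrite opprD [lie u1 v2]lie_anti [lie u2 v1]lie_anti addrC.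
Qed.

Fact lieC_linearl v : linear (lieC^~ v).
Proof.
by move=> a x y; rewrite /= lieC_anti lieC_linearr opprD -scalerN -!lieC_anti.
Qed.

Fact lieC_jacobi u v w :
  lieC u (lieC v w) + lieC v (lieC w u) + lieC w (lieC u v) = 0.
Proof.
case: u v w => [u1 u2] [v1 v2] [w1 w2]; congr (_, _) => /=.
  rewrite !(lieDr, lieNr) !opprD !addrA.
  rewrite [LHS](ACl ((1*5*9)*((2*8*11)*((3*6*12)*(4*7*10))))).
  by rewrite /= -!opprD !lie_jacobi !(addr0, oppr0).
rewrite !(lieDr, lieNr) !addrA.
rewrite [LHS](ACl ((1*6*11)*((2*7*9)*((3*5*10)*(4*8*12))))).
by rewrite /= -!opprD !lie_jacobi !(addr0, oppr0).
Qed.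

HB.instance Definition _ := Vector_isLie.Build R[i] gC
  lieC_linearl lieC_linearr lieC_alt lieC_jacobi.

Definition to_complexification (x : g) : gC := (x, 0).

(* The 'i * r-eigenspace of ad xi on the complexification, written g_r. *)
Definition ad_eigenspace (xi : g) (r : R) : {vspace gC} :=
  leigenspace (ad (to_complexification xi)) ('i%C * r%:C).

(* Membership in the sum of all g_i, i >= m; a vector of an infinite sum of
   subspaces lies in a finite subsum. *)
Definition in_ad_eigenspaces_from (xi : g) (m : nat) (v : gC) : Prop :=
  exists n : nat, v \in (\sum_(m <= i < n) ad_eigenspace xi i%:R)%VS.

Definition ad_integral (xi : g) : Prop :=
  forall a : R[i], leigenvalue (ad (to_complexification xi)) a ->
    exists k : int, a = 'i%C * k%:~R.

Definition canonical_element (q : {vspace gC}) (xi : g) : Prop :=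
  [/\ ad_integral xi,
      forall v, v \in q <-> in_ad_eigenspaces_from xi 0 v &
      forall r, (1 <= r)%N -> forall v,
        v \in central_series (polar q) r <-> in_ad_eigenspaces_from xi r v].

Definition compact_semisimple : Prop :=
  forall x : g, x != 0 -> killing x x < 0.

End Lie.
End Complexification.

Arguments compact_semisimple {R} g.

(* Main.v *)
(* For integral [xi], the complexification [gC] is the direct sum of the
   eigenspaces [E k] of [ad xi]: conjugation maps [E k] to [E (- k)] and
   [- K(u, conj v)] is a positive definite Hermitian form, [K] being the Killing
   form. If [xi] is canonical for [q], the degree [r + 1] part of
   [n^(r+1) = [n, n^(r)]] reads [E (r + 1) = [E 1, E r]]; together with the
   conjugate identities this generates [gC]. Conversely, put
   [Q 1 = E 1] and [Q (r + 1) = [E 1, Q r]]; the sum of the [E k], [k <= 0], and of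
   the [Q r], [r >= 1], is stable under [E 1], [E 0] and [E (-1)], so it is an
   ideal containing generators: [Q r = E r]. This is the description of the
   central series of the polar of the sum [q] of the [E k], [k >= 0]. Finally, a
   maximal solvable subalgebra containing [xi] and the polar of [q] is homogeneous
   and cannot meet [E (- k)], [k > 0], hence lies in [q]. *)
From HB Require Import structures.
Require Import Defs.
From mathcomp Require Import all_boot all_order all_algebra.
From mathcomp Require Import complex reals.
From mathcomp Require boolp.

Set Implicit Arguments.
Unset Strict Implicit.
Unset Printing Implicit Defensive.

Import Order.TTheory GRing.Theory Num.Theory passmx.
Local Open Scope ring_scope.

(** * Eigenspaces of endomorphisms *)

Section VectorSpaces.
Variables (F : fieldType) (V : vectType F).
Implicit Types (f : 'End(V)) (U W : {vspace V}) (a b : F).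

Lemma subv_sum_seqP (I : eqType) (s : seq I) (U : I -> {vspace V}) W :
  reflect {in s, forall i, (U i <= W)%VS} (\sum_(i <- s) U i <= W)%VS.
Proof.
elim: s => [|i s IHs]; first by rewrite big_nil sub0v; constructor.
rewrite big_cons subv_add; apply: (iffP andP) => [[sUi /IHs sUs] j|sU].
  by rewrite inE => /predU1P[-> // | /sUs].
split; first by apply: sU; rewrite mem_head.
by apply/IHs => j sj; apply: sU; rewrite inE sj orbT.
Qed.

Lemma sumv_seq_sup (I : eqType) (s : seq I) (U : I -> {vspace V}) i :
  i \in s -> (U i <= \sum_(j <- s) U j)%VS.
Proof. by move: i; apply/subv_sum_seqP. Qed.

Lemma memv_bigcap_seq (I : Type) (s : seq I) (U : I -> {vspace V}) x :
  (x \in \bigcap_(i <- s) U i)%VS = all (fun i => x \in U i) s.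
Proof.
elim: s => [|i s IHs]; first by rewrite big_nil memvf.
by rewrite big_cons memv_cap IHs.
Qed.

Lemma leigenspaceP f a v : reflect (f v = a *: v) (v \in leigenspace f a).
Proof.
rewrite memv_ker add_lfunE opp_lfunE scale_lfunE id_lfunE subr_eq0.
exact: eqP.
Qed.

Lemma leigenvalueE f a :
  leigenvalue f a = eigenvalue (mxof (vbasis {:V}) (vbasis {:V}) f) a.
Proof.
by rewrite /leigenvalue (leigenspaceE (vbasisP _)) vsof_eq0 ?vbasisP.
Qed.

Definition lfun_stable f W := (f @: W <= W)%VS.

Lemma lfun_stableP f W : reflect {in W, forall v, f v \in W} (lfun_stable f W).
Proof.
apply: (iffP subvP) => [sW v Wv | sW _ /memv_imgP[v Wv ->]].
  by apply: sW; apply: memv_img.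
exact: sW.
Qed.

(* The value at [f] of the product of the [(X - b) / (a - b)], [b != a] in [s]. *)
Fixpoint eigenproj f a (s : seq F) : 'End(V) :=
  if s is b :: s' then
    if b == a then eigenproj f a s'
    else ((a - b)^-1 *: (f - b *: \1) \o eigenproj f a s')%VF
  else \1%VF.

(** A polynomial in [f] preserves every [f]-stable subspace. Later this makes [ad xi]-stable
    subspaces homogeneous. *)
Lemma eigenproj_stable f a s W :
  lfun_stable f W -> lfun_stable (eigenproj f a s) W.
Proof.
move=> /lfun_stableP fW; apply/lfun_stableP.
elim: s => [|b s IHs] v Wv /=; first by rewrite id_lfunE.
case: ifP => _; first exact: IHs.
rewrite comp_lfunE scale_lfunE add_lfunE opp_lfunE scale_lfunE id_lfunE.
by rewrite memvZ // memvB ?memvZ ?fW ?IHs.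
Qed.

Lemma eigenproj_id f a s v : v \in leigenspace f a -> eigenproj f a s v = v.
Proof.
move=> fv; elim: s => [|b s IHs] /=; first by rewrite id_lfunE.
have [// | neq_ba] := eqVneq b a.
rewrite comp_lfunE IHs scale_lfunE add_lfunE opp_lfunE scale_lfunE id_lfunE.
rewrite (leigenspaceP _ _ _ fv) -scalerBl scalerA mulVf ?scale1r //.
by rewrite subr_eq0 eq_sym.
Qed.

(** The factors applied before the one for [b] keep [v] in the [b]-eigenspace, which that factor
    then kills. *)
Lemma eigenproj_0 f a b s v :
  b \in s -> b != a -> v \in leigenspace f b -> eigenproj f a s v = 0.
Proof.
move=> + neq_ba fv; elim: s => //= c s IHs; rewrite inE => /predU1P[<- | sb].
  rewrite (negPf neq_ba) comp_lfunE.
  have /lfun_stableP : lfun_stable (eigenproj f a s) (leigenspace f b).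
    apply/eigenproj_stable/lfun_stableP => w /leigenspaceP fw.
    by apply/leigenspaceP; rewrite fw linearZ /= fw.
  move=> /(_ v fv)/leigenspaceP fpv.
  by rewrite scale_lfunE add_lfunE opp_lfunE scale_lfunE id_lfunE fpv subrr scaler0.
by case: ifP => _; [exact: IHs | rewrite comp_lfunE IHs ?linear0].
Qed.

End VectorSpaces.

Section Spectrum.
Variables (C : numClosedFieldType) (V : vectType C).

Lemma leigenvalue_finite (f : 'End(V)) :
  exists s : seq C, forall a, leigenvalue f a -> a \in s.
Proof.
set p := char_poly (mxof (vbasis {:V}) (vbasis {:V}) f).
have p_neq0 : p != 0 by rewrite monic_neq0 ?char_poly_monic.
have [s def_p] := closed_field_poly_normal p.
exists s => a; rewrite leigenvalueE eigenvalue_root_char -/p def_p.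
by rewrite rootZ ?lead_coef_eq0 // root_prod_XsubC.
Qed.

Lemma stable_eigenvector (f : 'End(V)) (W : {vspace V}) :
  lfun_stable f W -> W != 0%VS ->
  exists a v, [/\ v \in W, v != 0 & f v = a *: v].
Proof.
move=> /lfun_stableP fW W_neq0.
(* The restriction of [f] to [W]; its matrix has positive size because [W] is nonzero, so it has an
   eigenvalue. *)
pose h : 'End(subvs_of W) := (linfun (vsproj W) \o f \o linfun vsval)%VF.
have [|a] := @eigenvalue_closed _ _
  (mxof (vbasis {:subvs_of W}) (vbasis {:subvs_of W}) h).
  by rewrite dimvf /dim /= lt0n dimv_eq0.
rewrite -leigenvalueE => /negP ha0.
pose w := vpick (leigenspace h a).
have w_neq0 : w != 0 by apply/negP; rewrite vpick0.
have /leigenspaceP : w \in leigenspace h a by exact: memv_pick.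
rewrite !comp_lfunE !lfunE /= => hw.
exists a, (vsval w); split; first exact: subvsP.
  by apply: contraNneq w_neq0 => w0; apply/eqP/val_inj.
by rewrite -[LHS](vsprojK (fW _ (subvsP w))) hw.
Qed.

End Spectrum.

(** * Killing form, normalizers, solvable subalgebras *)

Section LieAlgebra.
Variables (F : fieldType) (L : lieAlgType F).
Implicit Types (x y z : L) (U V W B : {vspace L}) (f g : 'End(L)).

Lemma lie_jacobi_deriv x y z : lie x (lie y z) = lie (lie x y) z + lie y (lie x z).
Proof.
have := lie_jacobi x y z.
rewrite [lie z x]lie_anti lieNr [lie z (lie x y)]lie_anti addrAC => xyz0.
by apply/eqP; rewrite -subr_eq0 opprD addrA xyz0.
Qed.

Lemma ad_lie x y : ad (lie x y) = ((ad x \o ad y) - (ad y \o ad x))%VF.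
Proof.
apply/lfunP => z; rewrite add_lfunE opp_lfunE !comp_lfunE !adE.
by rewrite [lie x (lie y z)]lie_jacobi_deriv addrK.
Qed.

(** Frees the trace from the choice of [vbasis], so that traces on [gC] can be computed in a basis
    coming from [g]. *)
Lemma lftrace_basis n (e : n.-tuple L) f :
  basis_of {:L} e -> lftrace f = \sum_i coord e i (f e`_i).
Proof.
move=> e_basis; set b := vbasis {:L}.
have b_basis : basis_of {:L} b by exact: vbasisP.
transitivity (\sum_i coord b i (f b`_i)).
  by apply: eq_bigr => i _; rewrite mxE /= vecof_delta mxE.
under eq_bigr => i _ do
  rewrite [in X in coord b i X](coord_basis e_basis (memvf b`_i)) !linear_sum.
rewrite exchange_big; apply: eq_bigr => j _ /=.
rewrite [in RHS](coord_basis b_basis (memvf (f e`_j))) linear_sum.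
by apply: eq_bigr => i _; rewrite !linearZ /= mulrC.
Qed.

Lemma lftrace_mulC f g : lftrace (f \o g)%VF = lftrace (g \o f)%VF.
Proof. by rewrite /lftrace !(mxof_comp _ _ (vbasisP _)) mxtrace_mulC. Qed.

Lemma lftraceB f g : lftrace (f - g) = lftrace f - lftrace g.
Proof. by rewrite /lftrace !linearB. Qed.

Lemma killingC x y : killing x y = killing y x.
Proof. exact: lftrace_mulC. Qed.

Lemma killingDr x y z : killing x (y + z) = killing x y + killing x z.
Proof. by have := killing_linearr x 1 y z; rewrite scale1r mul1r. Qed.

Lemma killing0r x : killing x 0 = 0.
Proof. by apply: (addrI (killing x 0)); rewrite -killingDr !addr0. Qed.

Lemma killingZr a x y : killing x (a *: y) = a * killing x y.
Proof. by have := killing_linearr x a y 0; rewrite killing0r !addr0. Qed.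

Lemma killingZl a x y : killing (a *: x) y = a * killing x y.
Proof. by rewrite killingC killingZr killingC. Qed.

Lemma killingDl x y z : killing (x + y) z = killing x z + killing y z.
Proof. by rewrite killingC killingDr ![killing z _]killingC. Qed.

(** Once both brackets are expanded, what remains is tr(YXZ) = tr(XZY), an instance of cyclicity. *)
Lemma killing_invariant x y z : killing (lie x y) z = killing x (lie y z).
Proof.
rewrite /killing !ad_lie !(comp_lfunDl, comp_lfunDr, comp_lfunNl, comp_lfunNr).
rewrite !lftraceB -!comp_lfunA; congr (_ - _).
by rewrite lftrace_mulC -comp_lfunA.
Qed.

Lemma polar_stable x U : lfun_stable (ad x) U -> lfun_stable (ad x) (polar U).
Proof.
move=> /lfun_stableP U_stable; apply/lfun_stableP => v /polarP Uv.
apply/polarP => u Uu; rewrite adE -killing_invariant lie_anti -scaleN1r.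
by rewrite killingZl Uv ?mulr0 // -adE U_stable.
Qed.

Lemma sub_polar_sym U V : (U <= polar V)%VS -> (V <= polar U)%VS.
Proof.
move=> /subvP sUV; apply/subvP => v Vv; apply/polarP => u /sUV/polarP Vu.
by rewrite killingC Vu.
Qed.

(** Rank-nullity for the pairing with a basis of [U]: the kernel lies in the polar, and the image
    has dimension at most that of [U]. *)
Lemma dim_polar U : (\dim {:L} <= \dim U + \dim (polar U))%N.
Proof.
pose h (x : L) : 'rV[F]_(\dim U) := \row_i killing (vbasis U)`_i x.
have h_linear : linear h.
  by move=> a x y; apply/rowP => i; rewrite !mxE; exact: killing_linearr.
pose hl : {linear L -> 'rV[F]_(\dim U)} :=
  HB.pack h (GRing.isLinear.Build F L 'rV[F]_(\dim U) _ h h_linear).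
rewrite -(limg_ker_dim (linfun hl) {:L}) capfv addnC leq_add //.
  by rewrite (leq_trans (dimvS (subvf _))) // dimvf dim_matrix mul1r.
apply/dimvS/subvP => x; rewrite memv_ker lfunE /= => /eqP/rowP hx.
rewrite memv_bigcap_seq; apply/(all_nthP 0) => i; rewrite size_tuple => lt_i.
by rewrite memv_ker lfunE /=; have := hx (Ordinal lt_i); rewrite !mxE => ->.
Qed.

Lemma lie_prodvS U U' V V' :
  (U <= U')%VS -> (V <= V')%VS -> (lie_prodv U V <= lie_prodv U' V')%VS.
Proof.
move=> /subvP sU /subvP sV; apply/lie_prodvP => u v /sU uU /sV vV.
exact: (lie_prodvP _ _ _ (subvv _)).
Qed.

Lemma mem_lie_prodv U V u v : u \in U -> v \in V -> lie u v \in lie_prodv U V.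
Proof. exact: (lie_prodvP _ _ _ (subvv _)). Qed.

Lemma lie_subalgP U :
  reflect {in U &, forall u v, lie u v \in U} (lie_subalg U).
Proof. by apply: (iffP (lie_prodvP _ _ _)) => U_lie u v; apply: U_lie. Qed.

Lemma lie_prodv_sum (I J : eqType) (s : seq I) (t : seq J)
    (U : I -> {vspace L}) (V : J -> {vspace L}) W :
  (forall i j u v, i \in s -> j \in t -> u \in U i -> v \in V j -> lie u v \in W) ->
  (lie_prodv (\sum_(i <- s) U i) (\sum_(j <- t) V j) <= W)%VS.
Proof.
move=> UV_W; apply/lie_prodvP => u v sum_u sum_v.
(* With one argument fixed, the condition on the other defines a subspace, so it can be tested on
   each summand. *)
suff: (\sum_(j <- t) V j <= ad u @^-1: W)%VS.
  by move/subvP/(_ v sum_v); rewrite -memv_preim adE.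
apply/subv_sum_seqP => j tj; apply/subvP => w Vw; rewrite -memv_preim adE.
suff: (\sum_(i <- s) U i <= ad w @^-1: W)%VS.
  by move/subvP/(_ u sum_u); rewrite -memv_preim adE lie_anti memvN.
apply/subv_sum_seqP => i si; apply/subvP => z Uz; rewrite -memv_preim adE.
by rewrite lie_anti memvN; apply: UV_W Uz Vw.
Qed.

Definition lie_normalizer V : {vspace L} :=
  (\bigcap_(v <- vbasis V) (ad v @^-1: V))%VS.

Lemma lie_normalizerP V x :
  reflect {in V, forall v, lie x v \in V} (x \in lie_normalizer V).
Proof.
rewrite memv_bigcap_seq; apply: (iffP allP) => [xV v Vv | xV v /vbasis_mem Vv].
  suff: (V <= ad x @^-1: V)%VS by move/subvP/(_ v Vv); rewrite -memv_preim adE.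
  rewrite -{1}(span_basis (vbasisP V)); apply/span_subvP => w /xV.
  by rewrite -!memv_preim !adE lie_anti memvN.
by rewrite -memv_preim adE lie_anti memvN xV.
Qed.

Lemma lie_normalizer_subalg V : lie_subalg (lie_normalizer V).
Proof.
apply/lie_subalgP => x y /lie_normalizerP Nx /lie_normalizerP Ny.
apply/lie_normalizerP => v Vv.
have -> : lie (lie x y) v = lie x (lie y v) - lie y (lie x v).
  by rewrite [lie x (lie y v)]lie_jacobi_deriv addrK.
by rewrite memvB ?Nx ?Ny ?Nx.
Qed.

(* The normalizer of [V] is a subalgebra containing [U], so [V] is an ideal. *)
Lemma lie_generates_stable U V :
  lie_generates U -> (U <= V)%VS -> (U <= lie_normalizer V)%VS -> V = fullv.
Proof.
move=> genU sUV sUN; apply/eqP; rewrite eqEsubv subvf /=.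
apply/subvP => x _; apply: (genU) sUV.
apply/lie_subalgP => u v Vu Vv.
by have /lie_normalizerP-> := genU u _ (lie_normalizer_subalg V) sUN.
Qed.

Lemma lie_derived_sub U k :
  lie_subalg U -> (iter k.+1 (fun V => lie_prodv V V) U
                   <= iter k (fun V => lie_prodv V V) U)%VS.
Proof. by move=> U_lie; elim: k => //= k IHk; rewrite lie_prodvS. Qed.

(** Induction on the codimension: a subalgebra that is not maximal is replaced by a strictly larger
    solvable one. *)
Lemma max_solvable_exists U : lie_subalg U -> lie_solvable U ->
  exists2 B, max_solvable_subalg B & (U <= B)%VS.
Proof.
have [n] := ubnP (\dim {:L} - \dim U).
elim: n U => // n IHn U; rewrite ltnS => dimU U_lie U_sol.
have [[B [sUB B_neqU B_lie B_sol]] | noB] := boolp.EM (exists B,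
    [/\ (U <= B)%VS, B <> U, lie_subalg B & lie_solvable B]).
  have ltUB : (\dim U < \dim B)%N.
    rewrite ltn_neqAle dimvS // andbT; apply/eqP => eqd; apply: B_neqU.
    by apply/esym/eqP; rewrite eqEdim sUB eqd /=.
  have [|//|//|B' maxB' sBB'] := IHn B.
    by rewrite (leq_trans _ dimU) // ltn_sub2l // (leq_trans ltUB) ?dimvS ?subvf.
  by exists B' => //; apply: subv_trans sBB'.
exists U => //; split=> // B B_lie B_sol sUB.
by apply: boolp.contrapT => neqBU; apply: noB; exists B.
Qed.

End LieAlgebra.

(** * Conjugation on the complexification *)

Section Conjugation.
Variables (R : rcfType) (g : lieAlgType R).
Local Open Scope complex_scope.
Local Notation gC := (complexification g).
Implicit Types (x y : g) (u v w : gC) (U V W : {vspace gC}).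

Definition gconj u : gC := (u.1, - u.2).

Lemma gconjK : involutive gconj.
Proof. by case=> x y; rewrite /gconj /= opprK. Qed.

Lemma gconjD u v : gconj (u + v) = gconj u + gconj v.
Proof. by rewrite /gconj /= opprD. Qed.

Lemma gconj0 : gconj 0 = 0.
Proof. by rewrite /gconj /= oppr0. Qed.

Lemma gconjZ a u : gconj (a *: u) = a^* *: gconj u.
Proof.
case: a u => a b [x y]; congr (_, _) => /=.
  by rewrite scalerN scaleNr opprK.
by rewrite scalerN scaleNr opprD.
Qed.

Lemma gconj_lie u v : gconj (lie u v) = lie (gconj u) (gconj v).
Proof.
congr (_, _) => /=; first by rewrite lieNl lieNr opprK.
by rewrite lieNl lieNr opprD.
Qed.

(** Conjugation is only antilinear, so the inclusion is carried over from the spanning vectors by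
    conjugating coordinates. *)
Lemma gconj_span (s : seq gC) W u :
  {in s, forall v, gconj v \in W} -> u \in <<s>>%VS -> gconj u \in W.
Proof.
move=> sW /(@coord_span _ _ _ (in_tuple s))->; elim/big_ind: _ => [|v w Wv Ww|i _].
- by rewrite gconj0 mem0v.
- by rewrite gconjD memvD.
by rewrite gconjZ memvZ // sW // mem_nth.
Qed.

Lemma gconj_lie_prodv U V U' V' u :
  {in U, forall v, gconj v \in U'} -> {in V, forall v, gconj v \in V'} ->
  u \in lie_prodv U V -> gconj u \in lie_prodv U' V'.
Proof.
move=> sU sV; apply: gconj_span => x /allpairsP[[v w] /=].
move=> [/vbasis_mem Uv /vbasis_mem Vw ->].
by rewrite gconj_lie mem_lie_prodv ?sU ?sV.
Qed.

Lemma complexificationE u :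
  u = to_complexification u.1 + 'i *: to_complexification u.2.
Proof.
case: u => x y; congr (_, _) => /=.
  by rewrite scale0r scaler0 subrr addr0.
by rewrite scale1r scaler0 !add0r.
Qed.

Definition complexification_tuple n (e : n.-tuple g) : n.-tuple gC :=
  [tuple of map (@to_complexification R g) e].

Lemma nth_complexification_tuple n (e : n.-tuple g) j :
  (complexification_tuple e)`_j = to_complexification e`_j.
Proof.
have [lt_jn | le_nj] := ltnP j n; first by rewrite (nth_map 0) ?size_tuple.
by rewrite !nth_default ?size_tuple.
Qed.

(** Splits a complex combination into two real ones; spanning and freeness over [R[i]] then follow
    from those of [e]. *)
Lemma sum_complexification_tuple n (e : n.-tuple g) (k : 'I_n -> R[i]) :
  \sum_j k j *: (complexification_tuple e)`_j
    = (\sum_j complex.Re (k j) *: e`_j, \sum_j complex.Im (k j) *: e`_j) :> gC.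
Proof.
elim/big_rec3: _ => // j y1 y2 y3 _ ->.
rewrite nth_complexification_tuple; case: (k j) => a b; congr (_, _) => /=.
  by rewrite scaler0 subr0.
by rewrite scaler0 add0r.
Qed.

Section Basis.
Variables (n : nat) (e : n.-tuple g).
Hypothesis e_basis : basis_of {:g} e.

Lemma complexification_decomp u :
  u = \sum_j (coord e j u.1 +i* coord e j u.2) *: (complexification_tuple e)`_j.
Proof.
rewrite sum_complexification_tuple /= -!(coord_basis e_basis) ?memvf //.
by case: u.
Qed.

Lemma complexification_basis : basis_of {:gC} (complexification_tuple e).
Proof.
have e_indep := elimT freeP (basis_free e_basis).
apply/andP; split.
  rewrite eqEsubv subvf; apply/subvP => u _; rewrite [u]complexification_decomp.
  by apply: memv_suml => j _; rewrite memvZ // memv_span // mem_nth ?size_tuple.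
apply/freeP => k; rewrite sum_complexification_tuple => -[/e_indep k1 /e_indep k2] j.
by apply/eqP; rewrite eq_complex k1 k2 !eqxx.
Qed.

Lemma coord_complexification (i : 'I_n) u :
  coord (complexification_tuple e) i u = coord e i u.1 +i* coord e i u.2.
Proof.
rewrite {1}[u]complexification_decomp coord_sum_free //.
exact: basis_free complexification_basis.
Qed.

End Basis.

Lemma lie_to_complexification x y :
  lie (to_complexification x) (to_complexification y)
    = to_complexification (lie x y).
Proof.
have lie0 (z : g) : lie z 0 = 0 by rewrite linear0.
by congr (_, _) => /=; rewrite !lie0 ?subr0 // add0r lie_anti lie0 oppr0.
Qed.

(** In a basis of [g], viewed in [gC], [ad] of a real element keeps its real matrix. *)
Lemma killing_to_complexification x y :
  killing (to_complexification x) (to_complexification y) = (killing x y)%:C.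
Proof.
have e_basis := vbasisP {:g}.
rewrite /killing (lftrace_basis _ (complexification_basis e_basis)).
rewrite (lftrace_basis _ e_basis) rmorph_sum; apply: eq_bigr => i _ /=.
rewrite coord_complexification // nth_complexification_tuple.
by rewrite !comp_lfunE !adE !lie_to_complexification /= linear0.
Qed.

(** The cross terms cancel by symmetry of the Killing form. *)
Lemma killing_gconj u :
  killing u (gconj u) = (killing u.1 u.1 + killing u.2 u.2)%:C.
Proof.
have -> : gconj u = to_complexification u.1 - 'i *: to_complexification u.2.
  rewrite {1}[u]complexificationE gconjD gconjZ -scaleNr /gconj /= oppr0.
  by congr (_ + _ *: _); apply/eqP; rewrite eq_complex /= oppr0 !eqxx.
rewrite {1}[u]complexificationE -scaleNr !(killingDl, killingDr, killingZl, killingZr).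
set x := to_complexification _; set y := to_complexification _.
rewrite [killing y x]killingC rmorphD /= -!killing_to_complexification -/x -/y.
by rewrite addrA mulNr addrNK mulNr mulrN mulrA -expr2 sqr_i mulN1r opprK.
Qed.

(** Two nonpositive reals with sum zero both vanish. Compactness enters the proof only through this
    lemma. *)
Lemma killing_gconj_neq0 u :
  compact_semisimple g -> u != 0 -> killing u (gconj u) != 0.
Proof.
move=> g_compact u_neq0; rewrite killing_gconj.
have K_le0 x : killing x x <= 0.
  have [->|/g_compact/ltW//] := eqVneq x 0.
  by rewrite killing0r.
apply/eqP => /complexI/eqP; rewrite naddr_eq0 // => /andP[/eqP K1 /eqP K2].
case/eqP: u_neq0; case: u K1 K2 => x y /= K1 K2.
by congr (_, _); apply/eqP; apply: contraT => /g_compact; rewrite ?K1 ?K2 ltxx.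
Qed.

End Conjugation.

(** * The grading by [ad xi] *)

Section Grading.
Variables (R : rcfType) (g : lieAlgType R) (xi : g).
Local Open Scope complex_scope.
Local Notation gC := (complexification g).
Local Notation xiC := (to_complexification xi).
Implicit Types (i j k l : int) (u v w : gC) (U V W : {vspace gC}).

Definition ad_eigenval k : R[i] := 'i%C * (k%:~R : R)%:C.

(* Locked: otherwise comparing two eigenspaces unfolds to Gaussian elimination. *)
Fact ad_graded_key : unit. Proof. by []. Qed.
Definition ad_graded : int -> {vspace gC} :=
  locked_with ad_graded_key (fun k => ad_eigenspace xi (k%:~R : R)).
Local Notation E := ad_graded.

Lemma ad_gradedE k : E k = ad_eigenspace xi k%:~R.
Proof. by rewrite /ad_graded unlock. Qed.

Lemma ad_eigenval_inj : injective ad_eigenval.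
Proof.
have i_neq0 : 'i%C != 0 :> R[i] by rewrite eq_complex /= oner_eq0 andbF.
by move=> j k /(mulfI i_neq0) /complexI; exact: intr_inj.
Qed.

Lemma ad_gradedP k v : reflect (lie xiC v = ad_eigenval k *: v) (v \in E k).
Proof. by rewrite -adE ad_gradedE; apply: leigenspaceP. Qed.

Lemma ad_graded_lie j k u v : u \in E j -> v \in E k -> lie u v \in E (j + k).
Proof.
move=> /ad_gradedP Eu /ad_gradedP Ev; apply/ad_gradedP.
rewrite lie_jacobi_deriv Eu Ev lieZl lieZr -scalerDl -mulrDr.
by rewrite -rmorphD /= -intrD.
Qed.

(** Leaves the target degree free, so that sums of degrees can be matched by computation. *)
Lemma ad_graded_lie_eq j k l u v :
  j + k = l -> u \in E j -> v \in E k -> lie u v \in E l.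
Proof. by move=> <-; apply: ad_graded_lie. Qed.

(** [xi] is real, and conjugation negates a purely imaginary eigenvalue. *)
Lemma ad_graded_gconj k v : v \in E k -> gconj v \in E (- k).
Proof.
move=> /ad_gradedP Ev; apply/ad_gradedP.
have -> : xiC = gconj xiC by rewrite /gconj /= oppr0.
rewrite -gconj_lie Ev gconjZ; congr (_ *: _); apply/eqP.
rewrite eq_complex /= !(mul0r, mul1r, mulr0, subr0, add0r, addr0) oppr0.
by rewrite mulrNz !eqxx.
Qed.

(** By invariance [ad xi] is skew for the Killing form, so j + k times the pairing is zero. *)
Lemma ad_graded_killing j k u v :
  u \in E j -> v \in E k -> j + k != 0 -> killing u v = 0.
Proof.
move=> /ad_gradedP Eu /ad_gradedP Ev jk_neq0.
have : killing (lie xiC u) v = - killing u (lie xiC v).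
  by rewrite -killing_invariant lie_anti -scaleN1r killingZl mulN1r.
rewrite Eu Ev killingZl killingZr => /eqP; rewrite -addr_eq0 -mulrDl mulf_eq0.
case/orP=> [|/eqP//]; rewrite -mulrDr -rmorphD /= -intrD.
have -> : 0 = ad_eigenval 0 by rewrite /ad_eigenval mulr0.
by move=> /eqP /ad_eigenval_inj jk0; rewrite jk0 in jk_neq0.
Qed.

Lemma ad_xi_graded : xiC \in E 0.
Proof. by apply/ad_gradedP; rewrite lie_alt /ad_eigenval mulr0 scale0r. Qed.

Lemma ad_graded_stable k : lfun_stable (ad xiC) (E k).
Proof.
apply/lfun_stableP => v Ev; rewrite adE.
by rewrite -[k]add0r ad_graded_lie ?ad_xi_graded.
Qed.

Lemma ad_spectrum : exists s : seq int, forall k, E k != 0%VS -> k \in s.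
Proof.
have [rs all_rs] := leigenvalue_finite (ad xiC).
suff [s all_s] : exists s : seq int, forall k, ad_eigenval k \in rs -> k \in s.
  by exists s => k; rewrite ad_gradedE => Ek; apply/all_s/all_rs.
elim: rs {all_rs} => [|r rs [s IHs]]; first by exists [::].
have [[j def_r] | no_j] := boolp.EM (exists j, ad_eigenval j = r).
  exists (j :: s) => k; rewrite !inE -def_r (inj_eq ad_eigenval_inj).
  by case/predU1P=> [->|/IHs->]; rewrite ?eqxx ?orbT.
exists s => k; rewrite inE => /predU1P[def_r|/IHs//].
by case: no_j; exists k.
Qed.

Section Spectrum.
Variable s : seq int.
Hypothesis s_spectrum : forall k, E k != 0%VS -> k \in s.
Hypothesis g_compact : compact_semisimple g.
Hypothesis xi_integral : ad_integral xi.

Lemma ad_graded_neq0 k v : v \in E k -> v != 0 -> k \in s.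
Proof.
move=> Ev v_neq0; apply: s_spectrum; apply: contraNneq v_neq0 => Ek0.
by rewrite -memv0 -Ek0.
Qed.

(* The Killing orthogonal of the sum of the eigenspaces is stable under
   [ad xi]; an eigenvector [w] in it would be orthogonal to its conjugate. *)
Lemma sum_ad_graded : (\sum_(k <- s) E k)%VS = fullv.
Proof.
set T := (\sum_(k <- s) E k)%VS.
have sET k : (E k <= T)%VS.
  have [-> | Ek] := eqVneq (E k) 0%VS; first exact: sub0v.
  by apply: sumv_seq_sup; apply: s_spectrum.
have T_stable : lfun_stable (ad xiC) T.
  apply/lfun_stableP; suff /subvP sTT : (T <= ad xiC @^-1: T)%VS.
    by move=> v /sTT; rewrite -memv_preim.
  apply/subv_sum_seqP => k _; apply/subvP => v Ev; rewrite -memv_preim.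
  by apply: (subvP (sET k)); apply: (lfun_stableP _ _ (ad_graded_stable k)).
have [polar0 | ] := eqVneq (polar T) 0%VS.
  apply/eqP; rewrite eqEdim subvf (leq_trans (dim_polar T)) //.
  by rewrite polar0 dimv0 addn0.
move=> /(stable_eigenvector (polar_stable T_stable))[a [w [/polarP Tw w_neq0]]].
move=> /leigenspaceP aw.
have [k def_a] : exists k : int, a = 'i%C * k%:~R.
  apply: xi_integral; apply: contraNneq w_neq0 => a0.
  by rewrite -memv0 -a0.
have Ew : w \in E k.
  by rewrite ad_gradedE; rewrite def_a -(rmorph_int (real_complex R)) in aw.
have := killing_gconj_neq0 g_compact w_neq0.
by rewrite killingC Tw ?eqxx // (subvP (sET (- k))) ?ad_graded_gconj.
Qed.

(** * Projections onto the eigenspaces *)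

Definition ad_proj k : 'End(gC) :=
  eigenproj (ad xiC) (ad_eigenval k) (map ad_eigenval s).

Lemma ad_proj_id k v : v \in E k -> ad_proj k v = v.
Proof. by rewrite ad_gradedE; apply: eigenproj_id. Qed.

Lemma ad_proj_0 j k v : v \in E j -> j != k -> ad_proj k v = 0.
Proof.
move=> Ev neq_jk; have [-> | v_neq0] := eqVneq v 0; first exact: linear0.
have sj := ad_graded_neq0 Ev v_neq0; rewrite ad_gradedE in Ev.
by apply: (eigenproj_0 (b := ad_eigenval j) _ _ Ev);
  rewrite ?map_f ?(inj_eq ad_eigenval_inj).
Qed.

Lemma ad_proj_stable k W v :
  lfun_stable (ad xiC) W -> v \in W -> ad_proj k v \in W.
Proof.
by move=> W_stable; apply: (lfun_stableP (ad_proj k) W (eigenproj_stable _ _ W_stable)).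
Qed.

Lemma ad_proj_graded k v : ad_proj k v \in E k.
Proof.
suff /subvP sTE : ({:gC} <= ad_proj k @^-1: E k)%VS.
  by rewrite memv_preim sTE ?memvf.
rewrite -sum_ad_graded; apply/subv_sum_seqP => j _; apply/subvP => w Ew.
rewrite -memv_preim; have [<-|neq_jk] := eqVneq j k; first by rewrite ad_proj_id.
by rewrite (ad_proj_0 Ew neq_jk) mem0v.
Qed.

Lemma ad_proj_decomp W v : (forall k, ad_proj k v \in W) -> v \in W.
Proof.
(* [s] may list a degree twice; [undup] counts each component once. *)
move=> Wv; suff -> : v = \sum_(k <- undup s) ad_proj k v by exact: memv_suml.
rewrite -sum_lfunE; set f := \sum_(k <- _) _.
suff /subvP/(_ v (memvf v)) : ({:gC} <= lker (f - \1%VF))%VS.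
  by move=> /eqlfunP->; rewrite id_lfunE.
rewrite -sum_ad_graded; apply/subv_sum_seqP => j sj; apply/subvP => w Ew.
apply/eqlfunP; rewrite id_lfunE sum_lfunE (bigD1_seq j) ?mem_undup ?undup_uniq //=.
rewrite ad_proj_id // big1 ?addr0 // => k neq_kj.
by rewrite (ad_proj_0 Ew) // eq_sym.
Qed.

(** A stable subspace contains the homogeneous components of its elements, so homogeneous vectors
    decide the inclusion. *)
Lemma ad_stable_sub W U : lfun_stable (ad xiC) W ->
  (forall k v, v \in W -> v \in E k -> v \in U) -> (W <= U)%VS.
Proof.
move=> W_stable WU; apply/subvP => v Wv; apply: ad_proj_decomp => k.
by apply: (WU k); rewrite ?ad_proj_graded ?ad_proj_stable.
Qed.

(** * The filtration by degree and its polar *)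

Definition ad_bound : nat := (\max_(k <- s) `|k|).+1.

(* The sum of the [E i] over all [i >= m], since [E i = 0] for [i >= ad_bound]. *)
Definition ad_filter (m : nat) : {vspace gC} :=
  (\sum_(m <= i < ad_bound) E i%:Z)%VS.
Local Notation F := ad_filter.

Lemma ad_filter_subP m W :
  reflect (forall n : nat, (m <= n)%N -> (E n <= W)%VS) (F m <= W)%VS.
Proof.
apply: (iffP (subv_sum_seqP _ _ _)) => [sEW n le_mn | sEW n]; last first.
  by rewrite mem_index_iota => /andP[/sEW].
have [-> | En] := eqVneq (E n) 0%VS; first exact: sub0v.
apply: sEW; rewrite mem_index_iota le_mn ltnS /=.
by rewrite -[n]/(`|n%:Z|)%N leq_bigmax_seq ?s_spectrum.
Qed.

Lemma ad_graded_filter m n : (m <= n)%N -> (E n <= F m)%VS.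
Proof. by move: n; apply/ad_filter_subP. Qed.

Lemma in_ad_eigenspaces_fromE m v : in_ad_eigenspaces_from xi m v <-> v \in F m.
Proof.
have sumE n :
  (\sum_(m <= i < n) ad_eigenspace xi i%:R = \sum_(m <= i < n) E i)%VS.
  by apply: eq_bigr => i _; rewrite ad_gradedE.
split=> [[n] | Fv]; last by exists ad_bound; rewrite sumE.
rewrite sumE; move: v; apply/subvP/subv_sum_seqP => i.
rewrite mem_index_iota => /andP[le_mi _].
exact: ad_graded_filter.
Qed.

Lemma ad_filterP m v : reflect (forall k, k < m%:Z -> ad_proj k v = 0) (v \in F m).
Proof.
apply: (iffP idP) => [Fv k lt_km | v0].
  suff /subvP/(_ v Fv) : (F m <= lker (ad_proj k))%VS by rewrite memv_ker => /eqP.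
  apply/ad_filter_subP => n le_mn; apply/subvP => w Ew; rewrite memv_ker.
  by rewrite (ad_proj_0 Ew) // gt_eqF // (lt_le_trans lt_km).
apply: ad_proj_decomp => k; have [/v0->|] := ltP k m%:Z; first exact: mem0v.
case: k => // n le_mn; apply: (subvP (ad_graded_filter le_mn)).
exact: ad_proj_graded.
Qed.

Lemma ad_filter_stable m : lfun_stable (ad xiC) (F m).
Proof.
apply/lfun_stableP => v; rewrite memv_preim; move: v; apply/subvP/ad_filter_subP.
move=> n le_mn; apply/subvP => v Ev; rewrite -memv_preim.
apply: (subvP (ad_graded_filter le_mn)).
exact: (lfun_stableP _ _ (ad_graded_stable n)).
Qed.

Lemma ad_filterS m n : (m <= n)%N -> (F n <= F m)%VS.
Proof.
move=> le_mn; apply/ad_filter_subP => i le_ni.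
by rewrite ad_graded_filter ?(leq_trans le_mn).
Qed.

Lemma lie_prodv_filter m n W :
  (forall i j : nat, (m <= i)%N -> (n <= j)%N -> forall u v,
    u \in E i -> v \in E j -> lie u v \in W) ->
  (lie_prodv (F m) (F n) <= W)%VS.
Proof.
move=> EW; apply: lie_prodv_sum => i j u v.
rewrite !mem_index_iota => /andP[le_mi _] /andP[le_nj _]; exact: EW.
Qed.

Lemma ad_filter_lie m n : (lie_prodv (F m) (F n) <= F (m + n)%N)%VS.
Proof.
apply: lie_prodv_filter => i j le_mi le_nj u v Eu Ev.
apply: (subvP (ad_graded_filter (leq_add le_mi le_nj))).
exact: (ad_graded_lie Eu Ev).
Qed.

(** A component of degree k <= 0 of a polar vector is again polar, and its conjugate has degree -k
    >= 0; being orthogonal to its conjugate, it vanishes. Conversely, a degree n >= 1 and a degree m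
    >= 0 never add up to zero. *)
Lemma polar_ad_filter : polar (F 0) = F 1.
Proof.
apply/eqP; rewrite eqEsubv; apply/andP; split.
  apply/subvP => v Pv; apply/ad_filterP => k lt_k1.
  set w := ad_proj k v.
  have Ew : w \in E k by exact: ad_proj_graded.
  have /polarP Pw : w \in polar (F 0).
    by apply: ad_proj_stable => //; apply/polar_stable/ad_filter_stable.
  apply/eqP; apply: contraT => /(killing_gconj_neq0 g_compact).
  rewrite killingC Pw ?eqxx //; case: k lt_k1 @w Ew {Pw} => [[|//]|n] _ w Ew.
    exact: (subvP (ad_graded_filter (leqnn 0)) _ (ad_graded_gconj Ew)).
  exact: (subvP (ad_graded_filter (leq0n n.+1)) _ (ad_graded_gconj Ew)).
apply/ad_filter_subP => n n_gt0.
apply/sub_polar_sym/ad_filter_subP => m _; apply/subvP => u Eu.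
apply/polarP => v Ev; apply: (ad_graded_killing Ev Eu).
by rewrite -PoszD eqz_nat addn_eq0 negb_and -lt0n n_gt0.
Qed.

(** * From a canonical element to generators *)

Lemma ad_graded_succ_filter n : lie_prodv (F 1) (F n) = F n.+1 ->
  (E n.+1 <= lie_prodv (E 1) (E n))%VS.
Proof.
move=> def_F; apply/subvP => v Ev.
suff /subvP/(_ v) : (F n.+1 <= ad_proj n.+1 @^-1: lie_prodv (E 1) (E n))%VS.
  rewrite -memv_preim ad_proj_id //; apply.
  exact: (subvP (ad_graded_filter (leqnn _))).
rewrite -def_F; apply: lie_prodv_filter => i j i_gt0 le_nj u w Eu Ew.
have Euw := ad_graded_lie Eu Ew; rewrite -memv_preim.
(* As i >= 1 and j >= n, total degree n + 1 forces i = 1 and j = n; all other brackets project to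
   zero. *)
have [def_n | neq_n] := eqVneq (i%:Z + j%:Z) n.+1.
  have [i1 jn] : i = 1%N /\ j = n.
    move: def_n; rewrite -PoszD => -[def_n].
    have: (i + j <= 1 + n)%N by rewrite def_n.
    have [-> | lt1i _] := eqVneq i 1%N.
      by rewrite leq_add2l => le_jn; split=> //; apply/eqP; rewrite eqn_leq le_jn.
    have: (1 + n < i + j)%N by rewrite -addSn leq_add // ltn_neqAle eq_sym lt1i.
    by rewrite def_n ltnn.
  rewrite def_n in Euw.
  rewrite (ad_proj_id Euw).
  apply: mem_lie_prodv.
    by rewrite i1 in Eu.
  by rewrite jn in Ew.
by rewrite (ad_proj_0 Euw neq_n) mem0v.
Qed.

Lemma ad_graded_opp_sub n :
  (E n.+1 <= lie_prodv (E 1) (E n))%VS ->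
  (E (- n.+1%:Z) <= lie_prodv (E (-1)) (E (- n%:Z)))%VS.
Proof.
move=> /subvP sE; apply/subvP => v Ev; rewrite -[v]gconjK.
have /sE : gconj v \in E n.+1 by rewrite -[n.+1%:Z]opprK ad_graded_gconj.
by apply: gconj_lie_prodv => w; apply: ad_graded_gconj.
Qed.

Lemma canonical_element_generates (q : {vspace gC}) :
  canonical_element q xi -> lie_generates (E 1 + E 0 + E (-1))%VS.
Proof.
move=> [_ _ q_series].
have series r : (0 < r)%N -> central_series (polar q) r = F r.
  move=> r_gt0; apply/vspaceP => v; apply/idP/idP.
    by move/(q_series r r_gt0)/(in_ad_eigenspaces_fromE).
  by move/(in_ad_eigenspaces_fromE)/(q_series r r_gt0).
have succ_sub n : (0 < n)%N -> (E n.+1 <= lie_prodv (E 1) (E n))%VS.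
  case: n => // n _; apply: ad_graded_succ_filter.
  by rewrite -!series.
move=> x V V_lie; rewrite !subv_add => /andP[/andP[sE1 sE0] sEm1].
have lieV U W : (U <= V)%VS -> (W <= V)%VS -> (lie_prodv U W <= V)%VS.
  by move=> sU sW; apply: subv_trans V_lie; apply: lie_prodvS.
have sE (n : nat) : (E n <= V)%VS /\ (E (- n%:Z) <= V)%VS.
  elim: n => [|n [IHn IHNn]]; first by rewrite oppr0.
  (* Degrees 1 and -1 are given; the recursion takes over from n = 1. *)
  have [->|n_gt0] := posnP n; first by split.
  split; first exact: subv_trans (succ_sub n n_gt0) (lieV _ _ sE1 IHn).
  exact: subv_trans (ad_graded_opp_sub (succ_sub n n_gt0)) (lieV _ _ sEm1 IHNn).
apply: (ad_proj_decomp) => k.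
have sEk : (E k <= V)%VS.
  by case: k => n; [have [] := sE n | have [_] := sE n.+1].
by rewrite (subvP sEk) // ad_proj_graded.
Qed.

(** * Parabolicity of the sum of the nonnegative degrees *)

(* Descending along [w |-> [[w, conj w], w]] stays in every derived subalgebra. *)
Lemma solvable_ad_graded (B : {vspace gC}) k v :
    lie_subalg B -> lie_solvable B -> k != 0 -> v \in E k ->
  v \in B -> gconj v \in B -> v = 0.
Proof.
move=> B_lie [n Bn0] k_neq0 Ev Bv Bcv; apply/eqP; apply: contraT => v_neq0.
pose D m := iter m (fun V => lie_prodv V V) B.
suff [w [_ w_neq0 Dw _]] :
    exists w, [/\ w \in E k, w != 0, w \in D n & gconj w \in D n].
  by move: Dw w_neq0; rewrite /D Bn0 memv0 => ->.
elim: n {Bn0} => [|m [w [Ew w_neq0 Dw Dcw]]]; first by exists v.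
pose y := lie w (gconj w).
have Dy : y \in D m.+1 by exact: mem_lie_prodv.
(* Bracketing [y] with [w] needs both in [D m] to land in [D m.+1]. *)
have Dmy : y \in D m := subvP (lie_derived_sub m B_lie) y Dy.
have y_conj : gconj y = - y by rewrite gconj_lie gconjK lie_anti.
(* If [y] were zero, pairing [xi] with it would give, by invariance, a nonzero multiple of K(w, conj
   w) equal to zero. *)
have y_neq0 : y != 0.
  apply: contraTneq (killing_gconj_neq0 g_compact w_neq0) => y0.
  have := killing_invariant xiC w (gconj w); rewrite -/y y0 killing0r.
  rewrite (ad_gradedP _ _ Ew) killingZl => /eqP; rewrite mulf_eq0 => /orP[|->//].
  have -> : 0 = ad_eigenval 0 by rewrite /ad_eigenval mulr0.
  by rewrite (inj_eq ad_eigenval_inj) (negPf k_neq0).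
exists (lie y w); split; last 2 first.
- exact: mem_lie_prodv.
- by rewrite gconj_lie y_conj mem_lie_prodv // memvN.
- have Ey : y \in E 0 by rewrite -(subrr k) ad_graded_lie ?ad_graded_gconj.
  by rewrite -[k]add0r ad_graded_lie.
(* If [y, w] = 0, invariance gives K(y, y) = 0, whereas conj y = -y. *)
apply: contraTneq (killing_gconj_neq0 g_compact y_neq0) => yw0.
have := killing_invariant y w (gconj w).
rewrite yw0 -/y -[X in killing y X](opprK y) -y_conj -[- _]scaleN1r killingZr.
by rewrite killingC killing0r mulN1r => /eqP; rewrite eq_sym oppr_eq0 negbK.
Qed.

Lemma parabolic_ad_filter : parabolic (F 0).
Proof.
split; first exact: (ad_filter_lie 0 0).
(* Adjoining [xi] makes any subalgebra containing [U] stable under [ad xi], hence homogeneous. *)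
pose U := (F 1 + <[xiC]>)%VS.
have derU : (lie_prodv U U <= F 1)%VS.
  apply/lie_prodvP => u' v' /memv_addP[u Fu [_ /vlineP[a ->] ->]].
  move=> /memv_addP[v Fv [_ /vlineP[b ->] ->]].
  have xiF := lfun_stableP _ _ (ad_filter_stable 1).
  rewrite lieDl !lieDr !lieZl !lieZr lie_alt !scaler0 addr0.
  rewrite [lie u xiC]lie_anti -!adE memvD ?memvD ?memvZ ?memvN ?xiF // adE.
  apply: (subvP (ad_filterS (isT : 1 <= 1 + 1)%N)).
  by rewrite (subvP (ad_filter_lie 1 1)) ?mem_lie_prodv.
have U_lie : lie_subalg U by apply: subv_trans derU (addvSl _ _).
(* Each bracket at least doubles the lowest degree, and a gain of one is enough to reach the empty
   sum at [ad_bound]. *)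
have derU_filter n : (iter n.+1 (fun V => lie_prodv V V) U <= F n.+1)%VS.
  elim: n => // n IHn; rewrite iterS (subv_trans (lie_prodvS IHn IHn)) //.
  rewrite (subv_trans (ad_filter_lie _ _)) // (ad_filterS) //.
  by rewrite addSn ltnS leq_addl.
have U_sol : lie_solvable U.
  exists ad_bound.+1; apply/eqP; rewrite -subv0 (subv_trans (derU_filter _)) //.
  by rewrite /ad_filter big_geq.
have [B maxB] := max_solvable_exists U_lie U_sol.
rewrite subv_add => /andP[sFB xiB].
exists B => //; have [B_lie B_sol _] := maxB.
apply: (ad_stable_sub) => [|k v Bv Ev].
  by apply/lfun_stableP => v Bv; rewrite adE (lie_subalgP _ B_lie).
(* In the negative case the degree is -(n + 1), so the conjugate lies in [F 1], hence in [B]. *)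
case: k Ev => n Ev; first exact: (subvP (ad_graded_filter (leq0n n))).
suff -> : v = 0 by exact: mem0v.
apply: (solvable_ad_graded B_lie B_sol _ Ev Bv) => //.
apply/(subvP sFB)/(subvP (ad_graded_filter (isT : 0 < n.+1)%N)).
exact: (ad_graded_gconj Ev).
Qed.

(** * From generators to a canonical element *)

Lemma iter_ad_graded1_sub n : (iter n (lie_prodv (E 1)) (E 1) <= E n.+1)%VS.
Proof.
elim: n => [|n IHn]; first exact: subvv.
apply/lie_prodvP => u v Eu /(subvP IHn) Ev.
by apply: (ad_graded_lie_eq _ Eu Ev).
Qed.

Lemma generated_ad_graded n : lie_generates (E 1 + E 0 + E (-1))%VS ->
  (E n.+1 <= iter n (lie_prodv (E 1)) (E 1))%VS.
Proof.
(* The index is shifted: [Q m] sits in degree m + 1. *)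
move=> genE; pose Q m := iter m (lie_prodv (E 1)) (E 1).
have Q0 m u v : u \in E 0 -> v \in Q m -> lie u v \in Q m.
  move=> Eu; elim: m v => [|m IHm] v Qv; first by apply: (ad_graded_lie_eq _ Eu Qv).
  suff /subvP/(_ v Qv) : (Q m.+1 <= ad u @^-1: Q m.+1)%VS by rewrite -memv_preim adE.
  apply/lie_prodvP => x y Ex Qy; rewrite -memv_preim adE lie_jacobi_deriv.
  by rewrite memvD ?mem_lie_prodv ?IHm //; apply: (ad_graded_lie_eq _ Eu Ex).
(* For m = 0 degrees suffice. Above, in [u, [x, y]] = [[u, x], y] + [x, [u, y]] the first term is
   handled by [Q0], as [u, x] has degree 0, and the second by induction. *)
have Qm1 m u v : u \in E (-1) -> v \in Q m.+1 -> lie u v \in Q m.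
  move=> Eu; elim: m v => [|m IHm] v Qv.
    suff /subvP/(_ v Qv) : (Q 1%N <= ad u @^-1: Q 0%N)%VS by rewrite -memv_preim adE.
    apply/lie_prodvP => x y Ex Ey; rewrite -memv_preim adE.
    exact: (ad_graded_lie Eu (ad_graded_lie Ex Ey)).
  suff /subvP/(_ v Qv) : (Q m.+2 <= ad u @^-1: Q m.+1)%VS by rewrite -memv_preim adE.
  apply/lie_prodvP => x y Ex Qy; rewrite -memv_preim adE lie_jacobi_deriv.
  apply: memvD; last by apply: mem_lie_prodv => //; apply: IHm.
  apply: (Q0 m.+1 _ _ _ Qy).
  by apply: (ad_graded_lie_eq _ Eu Ex).
(* Only the positive degrees are replaced by the possibly smaller [Q]. *)
pose U (k : int) := if k is n.+1%:Z then Q n else E k.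
have UE k : (U k <= E k)%VS.
  by case: k => [[|m]|m]; [exact: subvv | exact: iter_ad_graded1_sub | exact: subvv].
pose V := (\sum_(k <- s) U k)%VS.
have sUV k : (U k <= V)%VS.
  have [U0|U_neq0] := eqVneq (U k) 0%VS; first by rewrite U0 sub0v.
  apply: sumv_seq_sup; apply: s_spectrum; apply: contraNneq U_neq0 => Ek0.
  by rewrite -subv0 -Ek0.
have U_step d u : u \in E d -> (forall k v, v \in U k -> lie u v \in U (d + k)) ->
    u \in lie_normalizer V.
  move=> Eu uU; apply/lie_normalizerP.
  suff /subvP sVV : (V <= ad u @^-1: V)%VS by move=> v /sVV; rewrite -memv_preim adE.
  apply/subv_sum_seqP => k _; apply/subvP => v /uU Uv.
  by rewrite -memv_preim adE (subvP (sUV (d + k))).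
have V_full : V = fullv.
  apply: (lie_generates_stable genE); rewrite !subv_add -?andbA; apply/and3P.
    by split; [exact: (sUV 1) | exact: (sUV 0) | exact: (sUV (-1))].
  split; apply/subvP => u Eu; apply: (U_step _ u Eu) => k v Uv.
  - case: k Uv => [[|m]|m] Uv.
    + by apply: (ad_graded_lie_eq _ Eu Uv).
    + exact: mem_lie_prodv.
    (* From degree -(m + 1) the bracket reaches -m <= 0, where [U] is still the whole eigenspace. *)
    + have := ad_graded_lie Eu Uv; rewrite NegzE.
      have -> : 1 + - m.+1%:Z = - m%:Z by rewrite -addn1 PoszD opprD addrC addrNK.
      by case: m {Uv}.
  - rewrite add0r; case: k Uv => [[|m]|m] Uv; last 1 first.
    + by rewrite -[Negz m]add0r; apply: (ad_graded_lie_eq _ Eu Uv).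
    + by rewrite -[Posz 0]add0r; apply: (ad_graded_lie_eq _ Eu Uv).
    + exact: Q0.
  (* Degree 1 drops into the full [E 0]; only degrees at least 2 call for [Qm1]. *)
  - case: k Uv => [[|[|m]]|m] Uv.
    + by apply: (ad_graded_lie_eq _ Eu Uv).
    + by apply: (ad_graded_lie_eq _ Eu Uv).
    + exact: Qm1.
    + by apply: (ad_graded_lie_eq _ Eu Uv).
apply/subvP => v Ev.
(* Projecting the full space [V] to degree n + 1 leaves only its summand [Q n]. *)
suff /subvP/(_ v (memvf v)) : ({:gC} <= ad_proj n.+1 @^-1: Q n)%VS.
  by rewrite -memv_preim ad_proj_id.
rewrite -V_full; apply/subv_sum_seqP => k _; apply/subvP => u Uu; rewrite -memv_preim.
have Eu := subvP (UE k) u Uu; have [def_k | neq_k] := eqVneq k n.+1.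
  by rewrite def_k in Uu Eu; rewrite ad_proj_id.
by rewrite (ad_proj_0 Eu neq_k) mem0v.
Qed.

Lemma generates_canonical_element :
  lie_generates (E 1 + E 0 + E (-1))%VS -> canonical_element (F 0) xi.
Proof.
move=> genE.
split=> // [v | r r_gt0 v]; first by rewrite (in_ad_eigenspaces_fromE).
rewrite (in_ad_eigenspaces_fromE) polar_ad_filter.
suff -> : central_series (F 1) r = F r by [].
case: r r_gt0 => // r _; elim: r => [//|r IHr].
rewrite /central_series /= -[iter r _ _]/(central_series (F 1) r.+1) IHr.
apply/eqP; rewrite eqEsubv (ad_filter_lie 1 r.+1) /=.
(* All degrees here are at least r + 2, hence of the form n + 2; there [E] lies in [[E 1],
   [Q n]]. *)
apply/ad_filter_subP => -[//|[//|n]]; rewrite ltnS => le_rn.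
apply: subv_trans (generated_ad_graded n.+1 genE) _.
apply: lie_prodvS; first exact: ad_graded_filter.
exact: subv_trans (iter_ad_graded1_sub n) (ad_graded_filter le_rn).
Qed.

End Spectrum.
End Grading.

Theorem theorem3p1 (R : realType) (g : lieAlgType R) (hg : compact_semisimple g)
    (xi : g) :
  (exists q : {vspace complexification g},
     parabolic q /\ canonical_element q xi) <->
  (ad_integral xi /\
   lie_generates
     (ad_eigenspace xi 1%R + ad_eigenspace xi 0%R
        + ad_eigenspace xi (-1)%R)%VS).
Proof.
have [s s_spectrum] := ad_spectrum xi.
have -> : ad_eigenspace xi (-1) = ad_graded xi (-1) by rewrite ad_gradedE mulrN1z.
rewrite -[ad_eigenspace xi 1](ad_gradedE xi 1) -[ad_eigenspace xi 0](ad_gradedE xi 0).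
split=> [[q [_ q_can]] | [xi_int genE]].
  have [xi_int _ _] := q_can; split=> //.
  exact: (canonical_element_generates s_spectrum hg xi_int q_can).
exists (ad_filter xi s 0); split.
  exact: (parabolic_ad_filter s_spectrum hg xi_int).
exact: (generates_canonical_element s_spectrum hg xi_int genE).
Qed.
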